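(* Let $n \geq 4$ be an integer. Then no right-angled Artin group is abstractly commensurable with $\mathrm{Out}(F_n)$.
   Context: $F_n$ denotes the free group of rank $n$ and $\mathrm{Out}(F_n)$ its outer automorphism group. Two groups are abstractly commensurable if they have isomorphic finite-index subgroups. To a finite (simplicial) graph $\Gamma$ one associates a right-angled Artin group: the group with one generator for each vertex of $\Gamma$ and one defining relator for each edge, namely the commutator of the two generators corresponding to the endpoints of the edge. *)

(* Defs.v *)
From HB Require Import structures.
From mathcomp Require Import all_boot.
From mathcomp Require Import boolp classical_sets functions cardinality.

Set Implicit Arguments.
Unset Strict Implicit.
Unset Printing Implicit Defensive.

Local Open Scope group_scope.

Section Words.
Context {X : Type}.

(* The letter (x, false) stands for x and (x, true) for x^-1. *)
Definition word := seq (X * bool).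

Definition letter_inv (l : X * bool) : X * bool := (l.1, ~~ l.2).

Definition word_inv (w : word) : word := rev (map letter_inv w).

Definition comm_word (x y : X) : word :=
  [:: (x, true); (y, true); (x, false); (y, false)].

(* Two words represent the same element of < X | R > iff they are related by a
   finite sequence of insertions and deletions of subwords x x^-1, x^-1 x and
   of subwords belonging to R. *)
Inductive pres_eq (R : set word) : word -> word -> Prop :=
| pres_refl u : pres_eq R u u
| pres_sym u v : pres_eq R u v -> pres_eq R v u
| pres_trans u v w : pres_eq R u v -> pres_eq R v w -> pres_eq R u w
| pres_cancel u l v : pres_eq R (u ++ [:: l; letter_inv l] ++ v) (u ++ v)
| pres_relator u r v : R r -> pres_eq R (u ++ r ++ v) (u ++ v).

End Words.

Arguments word : clear implicits.

Section WordTheory.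
Variables (X : Type) (R : set (word X)).
Implicit Types u v w : word X.

Lemma letter_invK : involutive (@letter_inv X).
Proof. by case=> x b; rewrite /letter_inv /= negbK. Qed.

Lemma pres_eq_ctx p q u v : pres_eq R u v -> pres_eq R (p ++ u ++ q) (p ++ v ++ q).
Proof.
elim=> {u v} [u|u v _|u v w _ huv _|u l v|u r v Rr].
- exact: pres_refl.
- exact: pres_sym.
- exact: pres_trans.
- rewrite -!catA !(catA p u) (catA [:: l; _]) catA -(catA (p ++ u)).
  exact: pres_cancel.
- by rewrite -!catA !(catA p u); apply: pres_relator.
Qed.

Lemma pres_eq_cat u u' v v' :
  pres_eq R u u' -> pres_eq R v v' -> pres_eq R (u ++ v) (u' ++ v').
Proof.
move=> hu hv; apply: (@pres_trans _ _ _ (u' ++ v)).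
  exact: (@pres_eq_ctx [::] v).
by have := pres_eq_ctx u' [::] hv; rewrite !cats0.
Qed.

Lemma word_invK : involutive (@word_inv X).
Proof.
by move=> w; rewrite /word_inv map_rev revK (mapK letter_invK).
Qed.

Lemma pres_eq_mulV w : pres_eq R (w ++ word_inv w) [::].
Proof.
elim: w => [|l w IHw]; first exact: pres_refl.
rewrite /word_inv map_cons rev_cons -cats1 -cat1s -catA (catA w).
apply: pres_trans (pres_eq_ctx [:: l] [:: letter_inv l] IHw) _.
exact: (@pres_cancel _ R [::] l [::]).
Qed.

Lemma pres_eq_mulVl w : pres_eq R (word_inv w ++ w) [::].
Proof. by rewrite -{2}(word_invK w); apply: pres_eq_mulV. Qed.

Lemma pres_eq_inv u v : pres_eq R u v -> pres_eq R (word_inv u) (word_inv v).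
Proof.
move=> huv; apply: (@pres_trans _ _ _ (word_inv u ++ (v ++ word_inv v))).
  rewrite -{1}(cats0 (word_inv u)); apply: pres_eq_cat (pres_refl _ _) _.
  exact/pres_sym/pres_eq_mulV.
apply: (@pres_trans _ _ _ (word_inv u ++ (u ++ word_inv v))).
  by apply: pres_eq_cat (pres_refl _ _) (pres_eq_cat _ (pres_refl _ _)); exact: pres_sym.
by rewrite catA; apply: (pres_eq_cat (pres_eq_mulVl u)); exact: pres_refl.
Qed.

Definition pres_eqb u v := `[< pres_eq R u v >].

Lemma pres_eqb_refl : reflexive pres_eqb.
Proof. by move=> u; apply/asboolP/pres_refl. Qed.

Lemma pres_eqb_sym : symmetric pres_eqb.
Proof. by move=> u v; apply/asboolP/asboolP; exact: pres_sym. Qed.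

Lemma pres_eqb_trans : transitive pres_eqb.
Proof.
by move=> v u w /asboolP huv /asboolP hvw; apply/asboolP/(pres_trans huv hvw).
Qed.

Canonical pres_equiv := EquivRel pres_eqb pres_eqb_refl pres_eqb_sym pres_eqb_trans.

End WordTheory.

Local Open Scope quotient_scope.

Section Presented.
Variables (X : choiceType) (R : set (word X)).

(* the group < X | R > *)
Definition presented : Type := {eq_quot (pres_equiv R)}.

HB.instance Definition _ := Choice.on presented.
HB.instance Definition _ := EqQuotient.on presented.

Lemma presented_piP (u v : word X) :
  reflect (\pi_presented u = \pi_presented v) (pres_eqb R u v).
Proof. by apply: (iffP idP) => [/eqmodP|/eqmodP]. Qed.

Definition pres_one : presented := \pi_presented [::].
Definition pres_mul (a b : presented) : presented := \pi_presented (repr a ++ repr b).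
Definition pres_inv (a : presented) : presented := \pi_presented (word_inv (repr a)).

Lemma pres_reprP (u : word X) : pres_eq R (repr (\pi_presented u)) u.
Proof. by apply/asboolP/presented_piP; rewrite reprK. Qed.

Lemma pres_mulE (u v : word X) :
  pres_mul (\pi u) (\pi v) = \pi_presented (u ++ v).
Proof. by apply/presented_piP/asboolP/pres_eq_cat; exact: pres_reprP. Qed.

Lemma pres_invE (u : word X) : pres_inv (\pi u) = \pi_presented (word_inv u).
Proof. by apply/presented_piP/asboolP/pres_eq_inv; exact: pres_reprP. Qed.

Lemma pres_mulA : associative pres_mul.
Proof.
by move=> a b c; rewrite -(reprK a) -(reprK b) -(reprK c) !pres_mulE catA.
Qed.

Lemma pres_mul1 : left_id pres_one pres_mul.
Proof. by move=> a; rewrite -(reprK a) pres_mulE. Qed.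

Lemma pres_mulr1 : right_id pres_one pres_mul.
Proof. by move=> a; rewrite -(reprK a) pres_mulE cats0. Qed.

Lemma pres_mulV : left_inverse pres_one pres_inv pres_mul.
Proof.
move=> a; rewrite -(reprK a) pres_invE pres_mulE.
exact/presented_piP/asboolP/pres_eq_mulVl.
Qed.

Lemma pres_mulrV : right_inverse pres_one pres_inv pres_mul.
Proof.
move=> a; rewrite -(reprK a) pres_invE pres_mulE.
exact/presented_piP/asboolP/pres_eq_mulV.
Qed.

HB.instance Definition _ :=
  isGroup.Build presented pres_mulA pres_mul1 pres_mulr1 pres_mulV pres_mulrV.

End Presented.

Definition free_group (n : nat) : groupType := presented (set0 : set (word 'I_n)).

(* For symmetric e, an edge {x, y} contributes both [x, y] and [y, x]; these
   are inverse to each other. *)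
Definition raag (V : finType) (e : rel V) : groupType :=
  presented [set w | exists x y, e x y /\ w = comm_word x y]%classic.

Section Aut.
Variable G : groupType.

Record aut : Type := Aut {
  aut_fun :> G -> G;
  aut_morph : {morph aut_fun : x y / x * y};
  aut_bij : bijective aut_fun }.

HB.instance Definition _ := gen_eqMixin aut.
HB.instance Definition _ := gen_choiceMixin aut.

Lemma autP (f g : aut) : f =1 g -> f = g.
Proof.
case: f g => [f fM fB] [g gM gB] /= /funext efg; case: g / efg gM gB => gM gB.
by congr Aut; exact: Prop_irrelevance.
Qed.

Definition aut_one : aut :=
  @Aut idfun (fun _ _ => erefl) (Bijective (fun=> erefl) (fun=> erefl)).

Lemma aut_comp_morph (f g : aut) : {morph f \o g : x y / x * y}.
Proof. by move=> x y /=; rewrite !aut_morph. Qed.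

Definition aut_mul (f g : aut) : aut :=
  Aut (aut_comp_morph f g) (bij_comp (aut_bij f) (aut_bij g)).

Lemma aut_inv_subproof (f : aut) :
  {g : aut | cancel f g /\ cancel g f}.
Proof.
apply: cid; have [g fK gK] := aut_bij f.
have gM : {morph g : x y / x * y}.
  by move=> x y; apply: (can_inj fK); rewrite aut_morph !gK.
by exists (Aut gM (Bijective gK fK)).
Qed.

Definition aut_inv (f : aut) : aut := sval (aut_inv_subproof f).

Lemma autK (f : aut) : cancel f (aut_inv f).
Proof. exact: (svalP (aut_inv_subproof f)).1. Qed.

Lemma autVK (f : aut) : cancel (aut_inv f) f.
Proof. exact: (svalP (aut_inv_subproof f)).2. Qed.

Lemma aut_mulA : associative aut_mul.
Proof. by move=> f g h; apply: autP. Qed.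

Lemma aut_mul1 : left_id aut_one aut_mul.
Proof. by move=> f; apply: autP. Qed.

Lemma aut_mulr1 : right_id aut_one aut_mul.
Proof. by move=> f; apply: autP. Qed.

Lemma aut_mulV : left_inverse aut_one aut_inv aut_mul.
Proof. by move=> f; apply: autP => x; rewrite /= autK. Qed.

Lemma aut_mulrV : right_inverse aut_one aut_inv aut_mul.
Proof. by move=> f; apply: autP => x; rewrite /= autVK. Qed.

HB.instance Definition _ :=
  isGroup.Build aut aut_mulA aut_mul1 aut_mulr1 aut_mulV aut_mulrV.

Lemma inn_morph (x : G) : {morph (fun y => x * y * x^-1) : y z / y * z}.
Proof. by move=> y z; rewrite -!mulgA mulKg. Qed.

Lemma inn_bij (x : G) : bijective (fun y => x * y * x^-1).
Proof.
exists (fun y => x^-1 * y * x) => y; first by rewrite -!mulgA mulVg mulg1 mulKg.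
by rewrite -!mulgA mulgV mulg1 mulVKg.
Qed.

Definition inn (x : G) : aut := Aut (@inn_morph x) (inn_bij x).

Lemma innM : {morph inn : x y / x * y}.
Proof. by move=> x y; apply: autP => z /=; rewrite invgM !mulgA. Qed.

Lemma inn1 : inn 1 = 1.
Proof. by apply: autP => z /=; rewrite mul1g invg1 mulg1. Qed.

Lemma aut1 (f : aut) : f 1 = 1.
Proof. by apply: (mulgI (f 1)); rewrite -aut_morph !mulg1. Qed.

Lemma autV (f : aut) x : f x^-1 = (f x)^-1.
Proof. by apply: (mulgI (f x)); rewrite -aut_morph !mulgV aut1. Qed.

Lemma aut_inn (f : aut) x : f * inn x = inn (f x) * f.
Proof. by apply: autP => y /=; rewrite !aut_morph autV. Qed.

(* f and g lie in the same coset of Inn(G), so out below is Aut(G)/Inn(G). *)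
Definition out_eq (f g : aut) : Prop := exists x, f = g * inn x.

Definition out_eqb (f g : aut) := `[< out_eq f g >].

Lemma out_eqb_refl : reflexive out_eqb.
Proof. by move=> f; apply/asboolP; exists 1; rewrite inn1 mulg1. Qed.

Lemma out_eq_sym f g : out_eq f g -> out_eq g f.
Proof.
by case=> x ->; exists x^-1; rewrite -mulgA -innM mulgV inn1 mulg1.
Qed.

Lemma out_eqb_sym : symmetric out_eqb.
Proof. by move=> f g; apply/asboolP/asboolP; exact: out_eq_sym. Qed.

Lemma out_eqb_trans : transitive out_eqb.
Proof.
move=> g f h /asboolP[x ->] /asboolP[y ->]; apply/asboolP.
by exists (y * x); rewrite innM mulgA.
Qed.

Canonical out_equiv := EquivRel out_eqb out_eqb_refl out_eqb_sym out_eqb_trans.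

Definition out : Type := {eq_quot out_equiv}.

HB.instance Definition _ := Choice.on out.
HB.instance Definition _ := EqQuotient.on out.

Lemma out_piP (f g : aut) : reflect (\pi_out f = \pi_out g) (out_eqb f g).
Proof. by apply: (iffP idP) => [/eqmodP|/eqmodP]. Qed.

Definition out_one : out := \pi_out (1 : aut).
Definition out_mul (a b : out) : out := \pi_out (repr a * repr b).
Definition out_inv (a : out) : out := \pi_out ((repr a)^-1).

Lemma out_reprP (f : aut) : out_eq (repr (\pi_out f)) f.
Proof. by apply/asboolP/out_piP; rewrite reprK. Qed.

Lemma out_mulE (f g : aut) : out_mul (\pi f) (\pi g) = \pi_out (f * g).
Proof.
apply/out_piP/asboolP; have [x ->] := out_reprP f; have [y ->] := out_reprP g.
exists (aut_inv g x * y).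
by rewrite innM !mulgA -(mulgA f g) (aut_inn g) autVK mulgA.
Qed.

Lemma out_invE (f : aut) : out_inv (\pi f) = \pi_out f^-1.
Proof.
apply/out_piP/asboolP; have [x ->] := out_reprP f; exists (f x)^-1.
apply: (mulgI (f * inn x)); rewrite mulgV {1}aut_inn -!mulgA mulVKg.
by rewrite -innM mulgV inn1.
Qed.

Lemma out_mulA : associative out_mul.
Proof.
by move=> a b c; rewrite -(reprK a) -(reprK b) -(reprK c) !out_mulE mulgA.
Qed.

Lemma out_mul1 : left_id out_one out_mul.
Proof. by move=> a; rewrite -(reprK a) out_mulE mul1g. Qed.

Lemma out_mulr1 : right_id out_one out_mul.
Proof. by move=> a; rewrite -(reprK a) out_mulE mulg1. Qed.

Lemma out_mulV : left_inverse out_one out_inv out_mul.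
Proof. by move=> a; rewrite -(reprK a) out_invE out_mulE mulVg. Qed.

Lemma out_mulrV : right_inverse out_one out_inv out_mul.
Proof. by move=> a; rewrite -(reprK a) out_invE out_mulE mulgV. Qed.

HB.instance Definition _ :=
  isGroup.Build out out_mulA out_mul1 out_mulr1 out_mulV out_mulrV.

End Aut.

Local Open Scope classical_set_scope.

Definition finite_index (G : groupType) (A : {pred G}) : Prop :=
  finite_set (range (fun g : G => [set (g * a)%g | a in [set` A]])).

(* f is only relevant on A: an isomorphism of the subgroup A onto the subgroup
   B is represented by any extension to the ambient groups. *)
Definition isomorphic_subgroups (G H : groupType) (A : {pred G}) (B : {pred H}) :
    Prop :=
  exists f : G -> H,
    {in A &, {morph f : x y / (x * y)%g}} /\ set_bij [set` A] [set` B] f.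

Definition commensurable (G H : groupType) : Prop :=
  exists (A : {pred G}) (B : {pred H}),
    [/\ group_closed A, group_closed B, finite_index A, finite_index B
      & isomorphic_subgroups A B].

(* Main.v *)
Require Import Defs.
From mathcomp Require Import all_boot.
From HB Require Import structures.
From mathcomp Require Import all_algebra.
From mathcomp Require Import boolp classical_sets cardinality.

(** The obstruction is a property of centralizers.  Say that an element g of a
group G has a central character if some homomorphism from the centralizer C(g)
to the integers does not vanish on g.

- Every nontrivial element of a right-angled Artin group A has a central
  character ([raag_central_char]).  For each vertex v, A embeds into
  F(A) x| A, where F(A) is the free group on the underlying set of A and A acts
  by conjugating the basis: v goes to the basis element v, every other vertex x
  to x in the factor A ([split], with left inverse [unsplit]).  Followed by the
  projection to A, this is the endomorphism of A killing v ([kill]).  Killing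
  all vertices one after the other trivializes A, so a given nontrivial element
  g can be followed until the first killing that makes it trivial; central
  characters pull back along homomorphisms, so g may be assumed to be killed by
  a single v.  Its image in F(A) x| A is then a nontrivial element w of the
  free group.  Everything commuting with w preserves the axis of w in the
  Cayley tree of F(A), and the translation length along this axis is the
  required character ([central_char_cyc]).

- Let h in a group H have infinite order, and suppose H is commensurable with a
  group whose nontrivial elements all have central characters.  Some power of h
  has a central character in a subgroup of finite index, and the transfer turns
  it into a central character of h in H ([transfer],
  [commensurable_central_char]).

- Let a, b, c, d be distinct basis elements of F_n and let g conjugate b and c
  by a and fix the rest of the basis ([twist]).  Because d is fixed, no positive
  power of g is inner ([twist_outer]).  But g has no central character in
  Aut(F_n), hence none in Out(F_n) ([twist_not_central_char]): modulo the
  involution b |-> b^-1, g is a product of transvections b |-> ba and c |-> ca,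
  and these are commutators inside C(g), since the transvection b |-> ba is the
  commutator of b |-> bc and c |-> ca, up to inverses. *)

Set Implicit Arguments.
Unset Strict Implicit.
Unset Printing Implicit Defensive.

Import GRing.Theory Num.Theory.

Local Open Scope group_scope.

(** * Homomorphisms out of a presented group *)

Section Morphisms.
Variables (G H : groupType) (f : G -> H).
Hypothesis fM : {morph f : x y / x * y}.

Lemma morph1 : f 1 = 1.
Proof. by apply: (mulgI (f 1)); rewrite -fM !mulg1. Qed.

Lemma morphV : {morph f : x / x^-1}.
Proof. by move=> x; apply: (mulgI (f x)); rewrite -fM !mulgV morph1. Qed.

End Morphisms.

Section Presented.
Variables (X : choiceType) (R : set (word X)).

Definition gen (x : X) : presented R := \pi_(presented R)%qT [:: (x, false)].

Lemma pres_piM (u v : word X) :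
  \pi_(presented R)%qT (u ++ v) = \pi_(presented R)%qT u * \pi_(presented R)%qT v.
Proof. by rewrite -pres_mulE. Qed.

Lemma pres_piV (u : word X) :
  \pi_(presented R)%qT (word_inv u) = (\pi_(presented R)%qT u)^-1.
Proof. by rewrite -pres_invE. Qed.

Lemma pres_pi_eq (u v : word X) :
  pres_eq R u v -> \pi_(presented R)%qT u = \pi_(presented R)%qT v.
Proof. by move=> uv; apply/presented_piP/asboolP. Qed.

Lemma presented_ind (P : presented R -> Prop) :
    P 1 -> (forall x g, P g -> P (gen x * g)) ->
    (forall x g, P g -> P ((gen x)^-1 * g)) ->
  forall g, P g.
Proof.
move=> P1 Pgen PgenV g; rewrite -(reprK g); elim: (repr g) => [|[x b] w IHw] //.
rewrite -cat1s pres_piM; case: b; last exact: Pgen.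
by rewrite (_ : [:: _] = word_inv [:: (x, false)]) // pres_piV; apply: PgenV.
Qed.

Lemma presented_morph_ext (H : groupType) (f f' : presented R -> H) :
    {morph f : x y / x * y} -> {morph f' : x y / x * y} ->
  (forall x, f (gen x) = f' (gen x)) -> f =1 f'.
Proof.
move=> fM f'M ff'; elim/presented_ind => [|x g IHg|x g IHg].
- by rewrite !morph1.
- by rewrite fM f'M ff' IHg.
- by rewrite fM f'M !morphV // ff' IHg.
Qed.

Section Lift.
Variables (H : groupType) (f : X -> H).

Fixpoint word_eval (w : word X) : H :=
  if w is (x, b) :: w' then (if b then (f x)^-1 else f x) * word_eval w' else 1.

Lemma word_eval_cat u v : word_eval (u ++ v) = word_eval u * word_eval v.
Proof.
by elim: u => [|[x b] u IHu] /=; rewrite ?mul1g // IHu mulgA.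
Qed.

Definition lift (g : presented R) : H := word_eval (repr g).

Hypothesis fR : forall r, R r -> word_eval r = 1.

(** Von Dyck: relators that evaluate to 1 make evaluation a function on the
presented group. *)
Lemma word_eval_pres u v : pres_eq R u v -> word_eval u = word_eval v.
Proof.
elim=> {u v} [//|u v _ -> //|u v t _ -> _ -> //|u [x b] v|u r v /fR r1].
  by rewrite !word_eval_cat /=; case: b; rewrite /= mulg1 ?mulVg ?mulgV mul1g.
by rewrite !word_eval_cat r1 mul1g.
Qed.

Lemma lift_pi w : lift (\pi_(presented R)%qT w) = word_eval w.
Proof. exact/word_eval_pres/pres_reprP. Qed.

Lemma liftM : {morph lift : x y / x * y}.
Proof.
move=> x y; rewrite -(reprK x) -(reprK y) -pres_piM !lift_pi.
exact: word_eval_cat.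
Qed.

Lemma lift_gen x : lift (gen x) = f x.
Proof. by rewrite lift_pi /= mulg1. Qed.

End Lift.

Lemma word_eval_gen w : word_eval gen w = \pi_(presented R)%qT w.
Proof.
elim: w => [|[x b] w IHw] //=; rewrite -cat1s pres_piM -IHw; case: b => //.
by rewrite -pres_piV.
Qed.

End Presented.

Definition free (X : choiceType) : groupType := presented (set0 : set (word X)).

Section FreeLift.
Variables (X : choiceType) (H : groupType) (f : X -> H).

Let set0R (r : word X) : (set0 : set (word X)) r -> word_eval f r = 1.
Proof. by []. Qed.

Definition free_lift : free X -> H := @lift X set0 H f.

Lemma free_lift_pi w : free_lift (\pi_(free X)%qT w) = word_eval f w.
Proof. exact: lift_pi set0R w. Qed.

Lemma free_liftM : {morph free_lift : x y / x * y}.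
Proof. exact: liftM set0R. Qed.

Lemma free_lift_gen x : free_lift (gen set0 x) = f x.
Proof. exact: lift_gen set0R x. Qed.

End FreeLift.

(** * Reduced words *)

Section Reduced.
Variable X : choiceType.
Implicit Types (l : X * bool) (u v w : word X).

Definition reduced w : bool := sorted (fun l l' => l' != letter_inv l) w.

(** Left multiplication by a letter, on reduced words; iterating it gives the
van der Waerden normal form [nf]. *)
Definition push l w : word X :=
  if w is l' :: w' then (if l' == letter_inv l then w' else l :: w) else [:: l].

Definition nf w : word X := foldr push [::] w.

Lemma letter_inv_neq l : letter_inv l != l.
Proof. by case: l => x []; rewrite /letter_inv xpair_eqE eqxx. Qed.

Lemma push_reduced l w : reduced w -> reduced (push l w).
Proof.
case: w => [|l' w] //= w_red; case: eqP => [_|/eqP l'l].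
  exact: path_sorted w_red.
by rewrite /= l'l.
Qed.

Lemma nf_reduced w : reduced (nf w).
Proof. by elim: w => //= l w IHw; apply: push_reduced. Qed.

Lemma nf_id w : reduced w -> nf w = w.
Proof.
elim: w => // l w IHw lw_red; rewrite /= IHw; last exact: path_sorted lw_red.
by case: w lw_red {IHw} => //= l' w /andP[/negbTE->].
Qed.

Lemma pushK l w : reduced w -> push l (push (letter_inv l) w) = w.
Proof.
case: w => [|l' w] /=; first by rewrite eqxx.
rewrite letter_invK; case: eqP => [->|_] /=; last by rewrite eqxx.
by case: w => [|l'' w] //= /andP[/negbTE-> _].
Qed.

(** [nf] acts through [push], and the pushes of mutually inverse letters are
mutually inverse on reduced words, so inserting a cancelling pair of letters
does not change the normal form. *)
Lemma nf_pres u v : pres_eq set0 u v -> nf u = nf v.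
Proof.
elim=> {u v} [//|u v _ -> //|u v t _ -> _ -> //|u l v|//].
rewrite /nf !foldr_cat /= pushK //; exact: nf_reduced.
Qed.

Lemma pres_nf w : pres_eq set0 w (nf w).
Proof.
elim: w => [|l w IHw] /=; first exact: pres_refl.
apply: pres_trans (pres_eq_cat (pres_refl _ [:: l]) IHw) _.
case: (nf w) => [|l' v] /=; first exact: pres_refl.
case: eqP => [->|_]; last exact: pres_refl.
exact: (@pres_cancel _ set0 [::] l v).
Qed.

Lemma nf_cat u v : nf (u ++ v) = nf (nf u ++ nf v).
Proof. exact: nf_pres (pres_eq_cat (pres_nf u) (pres_nf v)). Qed.

Lemma reduced_cat u v : reduced (u ++ v) -> reduced u /\ reduced v.
Proof. by move=> /cat_sorted2[]. Qed.

(** Being reduced is a condition on adjacent letters only. *)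
Lemma reduced_glue u v w :
  v != [::] -> reduced (u ++ v) -> reduced (v ++ w) -> reduced (u ++ v ++ w).
Proof.
case: v => // l v _; case: u => [//|l' u] /=.
by rewrite !cat_path /= !cat_path => /and3P[-> -> _] /andP[-> ->].
Qed.

Lemma word_inv_cat u v : word_inv (u ++ v) = word_inv v ++ word_inv u.
Proof. by rewrite /word_inv map_cat rev_cat. Qed.

Lemma size_word_inv w : size (word_inv w) = size w.
Proof. by rewrite size_rev size_map. Qed.

(** The cancellation in a product of two reduced words takes place between a
suffix of the first and a prefix of the second. *)
Lemma reduced_cancel u v : reduced u -> reduced v ->
  exists u1 q v2, [/\ u = u1 ++ q, v = word_inv q ++ v2 & reduced (u1 ++ v2)].
Proof.
elim/last_ind: u v => [|u l IHu] v u_red v_red; first by exists [::], [::], v.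
case: v v_red => [|l' v] v_red.
  by exists (rcons u l), [::], [::]; rewrite !cats0.
case: (eqVneq l' (letter_inv l)) => [->|l'l].
  move: u_red; rewrite -cats1 => /reduced_cat[u_red _].
  have [u1 [q [v2 [-> -> uv]]]] := IHu v u_red (path_sorted v_red).
  exists u1, (rcons q l), v2; rewrite -!cats1 !catA; split=> //.
  by rewrite word_inv_cat.
exists (rcons u l), [::], (l' :: v); rewrite cats0; split=> //.
rewrite -cats1 -catA; apply: reduced_glue => //; first by rewrite cats1.
by rewrite /= l'l.
Qed.

Lemma nf_cancel u q v : nf ((u ++ q) ++ word_inv q ++ v) = nf (u ++ v).
Proof.
apply: nf_pres; rewrite -catA (catA q).
by apply: (@pres_eq_ctx _ _ u v (q ++ word_inv q) [::]); apply: pres_eq_mulV.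
Qed.

Definition wpow w n : word X := flatten (nseq n w).

Lemma wpowD w m n : wpow w (m + n) = wpow w m ++ wpow w n.
Proof. by rewrite /wpow nseqD flatten_cat. Qed.

Lemma size_wpow w n : size (wpow w n) = (n * size w)%N.
Proof. by elim: n => //= n IHn; rewrite size_cat IHn mulSn. Qed.

(** Squares detect cyclic cancellation: the first letter of the second copy
meets the last letter of the first. *)
Definition cyc_reduced w : bool := (w != [::]) && reduced (w ++ w).

Lemma wpow_reduced w n : cyc_reduced w -> reduced (wpow w n).
Proof.
case/andP=> w0 ww; case: n => // n; elim: n => [|n IHn].
  by rewrite /wpow /= cats0; have [] := reduced_cat ww.
by apply: (@reduced_glue w w (wpow w n)).
Qed.

(** Write |u| for the length of the normal form of u.  No cancellation takes
place in the middle of u w^m w^n v: a letter of nf u or nf v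
cancels at most one letter of the powers, so with m > |u| and n > |v| something
of both powers survives, and the surviving parts meet inside a power of w, which
is reduced. *)
Lemma size_nf_wpow w u v m n :
    cyc_reduced w -> size (nf u) < m -> size (nf v) < n ->
  size (nf ((u ++ wpow w m) ++ (wpow w n ++ v)))
    = size (nf (u ++ wpow w m)) + size (nf (wpow w n ++ v)).
Proof.
move=> w_cyc um vn.
have wn k : k <= size (wpow w k).
  by rewrite size_wpow leq_pmulr // lt0n size_eq0; case/andP: w_cyc.
have [u1 [q [p [uE pE u1p]]]] :=
  reduced_cancel (nf_reduced u) (wpow_reduced m w_cyc).
have [p' [q' [v2 [p'E vE p'v2]]]] :=
  reduced_cancel (wpow_reduced n w_cyc) (nf_reduced v).
have pN0 : p != [::].
  apply: contraTneq um => p0; rewrite -leqNgt (leq_trans (wn m)) //.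
  by rewrite pE p0 uE !size_cat size_word_inv addn0 leq_addl.
have p'N0 : p' != [::].
  apply: contraTneq vn => p0; rewrite -leqNgt (leq_trans (wn n)) //.
  by rewrite p'E p0 vE !size_cat size_word_inv leq_addr.
have pp' : reduced (p ++ p').
  have := wpow_reduced (m + n) w_cyc; rewrite wpowD pE p'E -catA.
  by case/reduced_cat => _; rewrite catA => /reduced_cat[].
have nfu : nf (u ++ wpow w m) = u1 ++ p.
  rewrite nf_cat uE (nf_id (wpow_reduced m w_cyc)) pE nf_cancel.
  exact: nf_id.
have nfv : nf (wpow w n ++ v) = p' ++ v2.
  rewrite nf_cat vE (nf_id (wpow_reduced n w_cyc)) p'E nf_cancel.
  exact: nf_id.
rewrite nf_cat nfu nfv nf_id ?size_cat //.
by rewrite -catA; do 2!apply: reduced_glue => //.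
Qed.

(** Every nontrivial reduced word is conjugate to a cyclically reduced one: as
long as the last letter cancels the first, strip both. *)
Lemma cyc_reduction w : reduced w -> w != [::] ->
  exists p c, cyc_reduced c /\ w = p ++ c ++ word_inv p.
Proof.
have [n] := ubnP (size w); elim: n => // n IHn in w * => wn w_red wN0.
have [ww|ww] := boolP (reduced (w ++ w)).
  by exists [::], w; rewrite /cyc_reduced ww wN0 cats0.
case: w wN0 w_red wn ww => // l w _; case/lastP: w => [_ _|w l' lw_red wn].
  by rewrite /= eq_sym letter_inv_neq.
have [lE _|l'l] := eqVneq l (letter_inv l'); last first.
  case/negP; rewrite -rcons_cons -{1}cats1 -catA; apply: reduced_glue => //.
    by rewrite cats1.
  by rewrite /= l'l.
rewrite {}lE in lw_red *.
have w0 : w != [::].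
  by apply: contraTneq lw_red => ->; rewrite /= letter_invK eqxx.
have w_red : reduced w.
  by move: lw_red; rewrite -cat1s -cats1 => /reduced_cat[_ /reduced_cat[]].
have {}wn : size w < n by rewrite /= size_rcons in wn; rewrite -ltnS ltnW.
have [p [c [c_cyc ->]]] := IHn w wn w_red w0.
exists (letter_inv l' :: p), c; split=> //.
rewrite -[_ :: p]cat1s word_inv_cat -cats1 /= -!catA; congr (_ :: _ ++ _ ++ _ ++ _).
by rewrite /word_inv /= letter_invK.
Qed.

End Reduced.

(** * Word length in a free group *)

Section FreeLength.
Variable X : choiceType.
Local Notation F := (free X).
Local Notation pi := (\pi_F%qT).

Definition len (g : F) : nat := size (nf (repr g)).

Lemma len_pi w : len (pi w) = size (nf w).
Proof. by rewrite /len (nf_pres (pres_reprP set0 w)). Qed.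

Lemma free_nf (g : F) : g = pi (nf (repr g)).
Proof. by rewrite -{1}(reprK g); apply/pres_pi_eq/pres_nf. Qed.

Lemma pi_wpow w n : pi (wpow w n) = pi w ^+ n.
Proof. by elim: n => // n IHn; rewrite expgS -IHn -pres_piM. Qed.

Lemma len_wpow w n : cyc_reduced w -> len (pi w ^+ n) = (n * size w)%N.
Proof.
move=> w_cyc; rewrite -pi_wpow len_pi nf_id ?size_wpow //.
exact: wpow_reduced.
Qed.

Lemma len_mul_wpow w (u v : F) m n :
    cyc_reduced w -> len u < m -> len v < n ->
  len (u * pi w ^+ m * (pi w ^+ n * v))
    = (len (u * pi w ^+ m) + len (pi w ^+ n * v))%N.
Proof.
have [u' ->] : exists u', u = pi u' by exists (repr u); rewrite reprK.
have [v' ->] : exists v', v = pi v' by exists (repr v); rewrite reprK.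
move=> w_cyc; rewrite -!pi_wpow -(pres_piM _ u') -(pres_piM _ _ v') -pres_piM !len_pi.
exact: size_nf_wpow.
Qed.

End FreeLength.

Section FreeMap.
Variables (X : choiceType).
Implicit Types k : X -> X.

Definition free_map k : free X -> free X := free_lift (fun x => gen set0 (k x)).

Lemma free_mapM k : {morph free_map k : x y / x * y}.
Proof. exact: free_liftM. Qed.

Lemma free_map_gen k x : free_map k (gen set0 x) = gen set0 (k x).
Proof. exact: free_lift_gen. Qed.

Lemma free_map_id g : free_map id g = g.
Proof.
apply: (@presented_morph_ext X set0 _ _ idfun) => // [|x].
  exact: free_mapM.
exact: free_map_gen.
Qed.

Lemma free_map_comp k k' g : free_map k (free_map k' g) = free_map (k \o k') g.
Proof.
apply: (@presented_morph_ext X set0 _ (free_map k \o free_map k')).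
- by move=> x y /=; rewrite !free_mapM.
- exact: free_mapM.
- by move=> x /=; rewrite !free_map_gen.
Qed.

Definition letter_map k (l : X * bool) : X * bool := (k l.1, l.2).

Lemma free_map_pi k w :
  free_map k (\pi_(free X)%qT w) = \pi_(free X)%qT (map (letter_map k) w).
Proof.
rewrite [LHS]free_lift_pi; elim: w => [//|[x b] w IHw].
rewrite map_cons -[in RHS]cat1s [RHS]pres_piM -IHw /=; case: b => //.
by rewrite -pres_piV.
Qed.

Section Injective.
Variable k : X -> X.
Hypothesis k_inj : injective k.

Lemma letter_map_inj : injective (letter_map k).
Proof. by move=> [x b] [y c] [/k_inj-> ->]. Qed.

Lemma reduced_map w : reduced (map (letter_map k) w) = reduced w.
Proof.
rewrite /reduced sorted_map; case: w => //= l w; apply: eq_path => l1 l2 /=.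
by congr (~~ _); exact: (inj_eq letter_map_inj l2 (letter_inv l1)).
Qed.

Lemma cyc_reduced_map w : cyc_reduced (map (letter_map k) w) = cyc_reduced w.
Proof. by rewrite /cyc_reduced -map_cat reduced_map; case: w. Qed.

Lemma len_free_map g : len (free_map k g) = len g.
Proof.
rewrite {1}(free_nf g) free_map_pi len_pi nf_id ?size_map //.
by rewrite reduced_map; apply: nf_reduced.
Qed.

End Injective.
End FreeMap.

(** * Characters of centralizers *)

(** The codomain int makes chi torsion-free valued: it vanishes on torsion, and a
nonzero value on a power of g comes from a nonzero value on g.  The values of
chi outside the centralizer are arbitrary. *)
Definition central_char (G : groupType) (g : G) : Prop :=
  exists2 chi : G -> int,
    (forall x y, commute g x -> commute g y -> chi (x * y) = (chi x + chi y)%R)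
    & chi g <> 0%R.

Lemma central_char_pullback (G H : groupType) (f : G -> H) (g : G) :
  {morph f : x y / x * y} -> central_char (f g) -> central_char g.
Proof.
move=> fM [chi chiM chig]; exists (chi \o f) => // x y gx gy /=.
by rewrite fM chiM // /commute -!fM ?gx ?gy.
Qed.

Section FreeConj.
Variable G : groupType.

Definition conj_by (k : G) (s : G) : G := k * s * k^-1.

Lemma conj_by_inj k : injective (conj_by k).
Proof. by move=> s t /mulIg /mulgI. Qed.

Definition free_act (k : G) : free G -> free G := free_map (conj_by k).

Lemma free_act1 u : free_act 1 u = u.
Proof.
rewrite /free_act (_ : conj_by 1 = id) ?free_map_id //.
by apply/funext => s; rewrite /conj_by mul1g invg1 mulg1.
Qed.

Lemma free_actM k k' u : free_act (k * k') u = free_act k (free_act k' u).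
Proof.
rewrite /free_act free_map_comp; congr (free_map _ u).
by apply/funext => s; rewrite /conj_by /= invgM !mulgA.
Qed.

(** The semidirect product F(G) x| G.  Conjugation by an element of G permutes
the basis G of F(G), so the action preserves word length. *)
Record free_conj : Type := FreeConj { fc_free : free G; fc_act : G }.

HB.instance Definition _ := gen_eqMixin free_conj.
HB.instance Definition _ := gen_choiceMixin free_conj.

Definition fc_one := FreeConj 1 1.
Definition fc_mul a b :=
  FreeConj (fc_free a * free_act (fc_act a) (fc_free b)) (fc_act a * fc_act b).
Definition fc_inv a :=
  FreeConj (free_act (fc_act a)^-1 (fc_free a)^-1) (fc_act a)^-1.

Lemma fc_mulA : associative fc_mul.
Proof.
move=> [u k] [u' k'] [u'' k'']; rewrite /fc_mul /= free_actM.
by rewrite [free_act k (_ * _)]free_mapM !mulgA.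
Qed.

Lemma fc_mul1 : left_id fc_one fc_mul.
Proof. by move=> [u k]; rewrite /fc_mul /= free_act1 !mul1g. Qed.

Lemma free_act_morph1 k : free_act k 1 = 1.
Proof. by apply: morph1; apply: free_mapM. Qed.

Lemma fc_mulr1 : right_id fc_one fc_mul.
Proof. by move=> [u k]; rewrite /fc_mul /= free_act_morph1 !mulg1. Qed.

Lemma fc_mulV : left_inverse fc_one fc_inv fc_mul.
Proof.
move=> [u k]; rewrite /fc_mul /fc_inv /= -[free_act _ _ * _]free_mapM.
by rewrite !mulVg; congr FreeConj; apply: free_act_morph1.
Qed.

Lemma fc_mulrV : right_inverse fc_one fc_inv fc_mul.
Proof.
by move=> [u k]; rewrite /fc_mul /fc_inv /= -free_actM mulgV free_act1 mulgV.
Qed.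

HB.instance Definition _ :=
  isGroup.Build free_conj fc_mulA fc_mul1 fc_mulr1 fc_mulV fc_mulrV.

Lemma fc_mulE (u v : free G) (k l : G) :
  FreeConj u k * FreeConj v l = FreeConj (u * free_act k v) (k * l).
Proof. by []. Qed.

Lemma fc_mul_free (u v : free G) :
  FreeConj u 1 * FreeConj v 1 = FreeConj (u * v) 1 :> free_conj.
Proof. by rewrite fc_mulE free_act1 mulg1. Qed.

Lemma free_actX k u n : free_act k (u ^+ n) = free_act k u ^+ n.
Proof.
elim: n => [|n IHn]; first exact: free_act_morph1.
by rewrite !expgS [LHS]free_mapM -IHn.
Qed.

(** The character is the Busemann function of the axis of w: the value at (u, k)
is |w^n u| - n|w|, which does not depend on n once n > |u|.  If (u, k) commutes
with w then w^n u = u k(w)^n, so that for a second such element (v, l)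
  w^(2n) u k(v) = (u k(w)^n) (k(w)^n k(v)) = (w^n u) . k(w^n v),
and for n large there is no cancellation at the middle dot; the letters of k(w)
are permuted copies of those of w, so lengths add up. *)
Lemma central_char_cyc (w : word G) :
  cyc_reduced w -> central_char (FreeConj (\pi_(free G)%qT w) 1).
Proof.
move=> w_cyc; set C := \pi_(free G)%qT w.
pose B n (u : free G) : int := ((len (C ^+ n * u))%:Z - (n * size w)%:Z)%R.
pose chi (x : free_conj) := B (len (fc_free x)).+1 (fc_free x).
have chiE n x : len (fc_free x) < n -> chi x = B n (fc_free x).
  have B1 u m : B (m + (len u).+1)%N u = B (len u).+1 u.
    case: m => // m; rewrite /B expgnDr -mulgA -[C ^+ m.+1]mul1g.
    rewrite len_mul_wpow //; last by rewrite len_pi.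
    by rewrite mul1g len_wpow // mulnDl !PoszD opprD addrACA subrr add0r.
  by move=> /subnK <-; rewrite B1.
exists chi => [[u k] [v l] Cx _|]; last first.
  rewrite /chi /B /= -expgSr !len_wpow // mulSn PoszD addrK.
  by case/andP: w_cyc; case: (w).
have {Cx} Cu : C * u = u * free_act k C.
  by move: Cx; rewrite /commute !fc_mulE free_act1 => -[].
have CuX n : C ^+ n * u = u * free_act k C ^+ n.
  elim: n => [|n IHn]; first by rewrite mulg1 mul1g.
  by rewrite !expgSr -mulgA Cu mulgA IHn mulgA.
pose n := (len u + len v + len (u * free_act k v)).+1.
have nu : len u < n by rewrite ltnS -addnA leq_addr.
have nv : len v < n by rewrite ltnS addnAC leq_addl.
have nuv : len (u * free_act k v) < n + n by rewrite ltn_addr // ltnS leq_addl.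
rewrite fc_mulE (chiE _ (FreeConj _ _) nuv) (chiE _ (FreeConj _ _) nu).
rewrite (chiE _ (FreeConj _ _) nv) /B /=.
suff -> : len (C ^+ (n + n) * (u * free_act k v))
            = (len (C ^+ n * u) + len (C ^+ n * v))%N.
  by rewrite mulnDl !PoszD opprD addrACA.
have kC : free_act k C = \pi_(free G)%qT (map (letter_map (conj_by k)) w).
  exact: free_map_pi.
have kv : len (free_act k v) < n by rewrite len_free_map //; apply: conj_by_inj.
rewrite expgnDr mulgA -(mulgA _ _ u) CuX -!mulgA mulgA CuX.
(* k C is again the class of a cyclically reduced word *)
rewrite {1}kC {1}kC len_mul_wpow ?cyc_reduced_map //; last exact: conj_by_inj.
rewrite -kC -free_actX -[free_act k _ * _]free_mapM len_free_map //.
exact: conj_by_inj.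
Qed.

End FreeConj.

(** Conjugation by an element of the free group reduces to the cyclically reduced
case. *)
Lemma central_char_free_conj (G : groupType) (u : free G) :
  u != 1 -> central_char (FreeConj u 1).
Proof.
move=> uN1; have nfu : nf (repr u) != [::].
  by apply: contraNneq uN1 => u0; rewrite (free_nf u) u0.
have [p [c [c_cyc uE]]] := cyc_reduction (nf_reduced (repr u)) nfu.
pose P : free_conj G := FreeConj (\pi_(free G)%qT p) 1.
apply: (@central_char_pullback _ _ (fun x => P^-1 * x * P)).
  by move=> x y; rewrite !mulgA mulgK.
suff -> : P^-1 * FreeConj u 1 * P = FreeConj (\pi_(free G)%qT c) 1.
  exact: central_char_cyc.
apply: (mulgI P); rewrite -mulgA mulVKg !fc_mul_free; congr FreeConj.
rewrite (free_nf u) uE !pres_piM pres_piV -!mulgA; congr (_ * _).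
by rewrite mulVg mulg1.
Qed.

(** * Right-angled Artin groups *)

Lemma word_eval_comm (X : choiceType) (H : groupType) (f : X -> H) (x y : X) :
  word_eval f (comm_word x y) = 1 <-> commute (f x) (f y).
Proof.
rewrite /= mulg1 /commute; split=> [xy|xy].
  by apply: (mulgI (f y)^-1); rewrite mulKg; apply: (mulgI (f x)^-1); rewrite xy mulVg.
by rewrite xy mulKg mulVg.
Qed.

Section Raag.
Variables (V : finType) (e : rel V).

Definition raag_relators : set (word V) :=
  [set w | exists x y, e x y /\ w = comm_word x y]%classic.

Local Notation A := (presented raag_relators).
Local Notation "<< x >>" := (gen raag_relators x).

Lemma raag_commute x y : e x y -> commute <<x>> <<y>>.
Proof.
move=> exy; apply/(@word_eval_comm V A).
rewrite word_eval_gen; apply: (@pres_pi_eq _ _ _ [::]).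
by have := @pres_relator _ raag_relators [::] (comm_word x y) [::]; apply; exists x, y.
Qed.

Lemma raag_lift_rel (H : groupType) (f : V -> H) :
    (forall x y, e x y -> commute (f x) (f y)) ->
  forall r, raag_relators r -> word_eval f r = 1.
Proof. by move=> fR _ [x [y [exy ->]]]; apply/word_eval_comm/fR. Qed.

Section Vertex.
Variable v : V.

(** A is the HNN extension of the subgroup A' generated by the other vertices
with stable letter v.  The normal closure of v is free on the conjugates of v by
A', which A' permutes, so A is a semidirect product of this free group with A'.
Using the free group on all of A instead makes injectivity immediate: evaluating
words in A is a left inverse. *)
Definition split_gen (x : V) : free_conj A :=
  if x == v then FreeConj (gen set0 <<v>>) 1 else FreeConj 1 <<x>>.

Lemma free_act_gen (k s : A) :
  free_act k (gen set0 s) = gen set0 (k * s * k^-1).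
Proof. exact: free_map_gen. Qed.

Lemma split_gen_commute x y : e x y -> commute (split_gen x) (split_gen y).
Proof.
have act1 z : e z v \/ e v z ->
    commute (FreeConj 1 <<z>>) (FreeConj (gen set0 <<v>>) 1).
  move=> zv; rewrite /commute !fc_mulE free_act1 free_act_gen !mulg1 !mul1g.
  suff -> : <<z>> * <<v>> = <<v>> * <<z>> by rewrite mulgK.
  by case: zv => /raag_commute.
rewrite /split_gen; case: (x =P v) => [->|_]; case: (y =P v) => [->|_] exy.
- exact: commute_refl.
- by apply/commute_sym/act1; right.
- by apply: act1; left.
- by rewrite /commute !fc_mulE !free_act_morph1 mulg1 raag_commute.
Qed.

Definition split : A -> free_conj A := @lift _ raag_relators _ split_gen.

Lemma split_rel r : raag_relators r -> word_eval split_gen r = 1.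
Proof. exact: (raag_lift_rel split_gen_commute). Qed.

Lemma splitM : {morph split : x y / x * y}.
Proof. exact: liftM split_rel. Qed.

Definition unsplit (a : free_conj A) : A := free_lift id (fc_free a) * fc_act a.

Lemma unsplitM : {morph unsplit : a b / a * b}.
Proof.
have liftJ k u : free_lift id (free_act k u) = k * free_lift id u * k^-1 :> A.
  apply: (@presented_morph_ext _ set0 A (free_lift id \o free_act k)
    (fun u => k * free_lift id u * k^-1)) => [x y|x y|x] /=.
  - by rewrite [free_act _ _]free_mapM free_liftM.
  - by rewrite free_liftM !mulgA mulgVK.
  - by rewrite free_act_gen !free_lift_gen.
by move=> [u k] [u' k']; rewrite /unsplit /= free_liftM liftJ !mulgA mulgVK.
Qed.

Lemma splitK : cancel split unsplit.
Proof.
apply: (@presented_morph_ext _ raag_relators A (unsplit \o split) id) => //.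
  by move=> x y /=; rewrite splitM unsplitM.
move=> x /=; rewrite [split _]lift_gen; last exact: split_rel.
rewrite /split_gen /unsplit; case: (x =P v) => [->|_] /=.
  by rewrite free_lift_gen mulg1.
by rewrite morph1 ?mul1g //; apply: free_liftM.
Qed.

Definition kill (g : A) : A := fc_act (split g).

Lemma killM : {morph kill : x y / x * y}.
Proof. by move=> x y; rewrite /kill splitM. Qed.

Lemma kill_gen x : kill <<x>> = if x == v then 1 else <<x>>.
Proof.
rewrite /kill [split _]lift_gen; last exact: split_rel.
by rewrite /split_gen; case: eqP.
Qed.

Lemma central_char_kill1 g : g != 1 -> kill g = 1 -> central_char g.
Proof.
rewrite /kill => gN1 gv; apply: (central_char_pullback splitM).
case splitg: (split g) gv => [u k] /= k1; rewrite {}k1 in splitg *.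
apply: central_char_free_conj; apply: contraNneq gN1 => u1.
by rewrite -(splitK g) splitg u1 /unsplit /= mulg1 morph1 //; apply: free_liftM.
Qed.

End Vertex.

(** Kill the vertices one by one: the image of g just before it becomes trivial
has a central character by [central_char_kill1], which pulls back to g. *)
Lemma raag_central_char (g : A) : g != 1 -> central_char g.
Proof.
pose kills s g := foldr kill g s.
have killsM s : {morph kills s : x y / x * y}.
  by rewrite /kills; elim: s => //= v s IHs x y; rewrite IHs killM.
have kills_gen s x : kills s <<x>> = if x \in s then 1 else <<x>>.
  rewrite /kills; elim: s => //= v s ->; rewrite in_cons; case: ifP => xs.
    by rewrite orbT morph1 //; apply: killM.
  by rewrite orbF kill_gen.
have kills1 h : kills (enum V) h = 1.
  apply: (@presented_morph_ext _ raag_relators A _ (fun=> 1)) => // [x y|x].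
    by rewrite mulg1.
  by rewrite kills_gen mem_enum.
suff main s h : kills s h = 1 -> h != 1 -> central_char h by apply: (main _ g).
elim/last_ind: s h => [|s v IHs] h /=; first by move=> ->; rewrite eqxx.
rewrite /kills foldr_rcons => hs hN1.
have [hv|hv] := eqVneq (kill v h) 1; first exact: (@central_char_kill1 v).
by apply: (central_char_pullback (killM v)); apply: IHs.
Qed.

End Raag.

(** * Transfer from subgroups of finite index *)

Section Transfer.
Variables (G : groupType) (B : {pred G}).
Hypothesis B_group : group_closed B.

Definition lcoset (x : G) : set G := [set (x * a)%g | a in [set` B]]%classic.

Lemma lcoset_eq x y : lcoset x = lcoset y <-> x^-1 * y \in B.
Proof.
split=> [xy|xy].
  have: lcoset y (y * 1) by exists 1 => //; exact: B_group.1.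
  by rewrite -xy mulg1 => -[a aB <-]; rewrite mulKg.
have sub u v : u^-1 * v \in B -> (lcoset v `<=` lcoset u)%classic.
  move=> uv _ [b bB <-]; exists (u^-1 * v * b); last by rewrite -mulgA mulVKg.
  exact: group_closedM.
apply/seteqP; split; last exact: sub.
apply: sub; rewrite -[x in _ * x]invgK -invgM.
exact: group_closedV.
Qed.

Lemma lcoset_mull h x y : lcoset (h * x) = lcoset (h * y) <-> lcoset x = lcoset y.
Proof. by rewrite !lcoset_eq invgM -mulgA mulKg. Qed.

Hypothesis B_index : finite_index B.

(** Pigeonhole on the cosets of the powers of g. *)
Lemma finite_index_power g : exists2 k, 0 < k & g ^+ k \in B.
Proof.
have /finite_seqP[X XE] := B_index.
have gX i : lcoset (g ^+ i) \in X.
  by have : range lcoset (lcoset (g ^+ i)) by []; rewrite XE.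
pose s := [seq lcoset (g ^+ i) | i <- iota 0 (size X).+1].
have /(uniqPn (lcoset 1))[i [j [ij]]] : ~~ uniq s.
  apply/negP => s_uniq.
  have: size s <= size X by apply: uniq_leq_size s_uniq _ => _ /mapP[i _ ->].
  by rewrite size_map size_iota ltnn.
rewrite size_map size_iota => jX.
rewrite !(nth_map 0) ?size_iota ?(ltn_trans ij) // !nth_iota ?(ltn_trans ij) //.
rewrite !add0n => /lcoset_eq gij; exists (j - i); first by rewrite subn_gt0.
move: gij; rewrite -{1}(subnKC (ltnW ij)) expgnDr mulKg; exact.
Qed.

(** The transfer for C(g) acting on its finitely many cosets c = xB with x in
C(g): with representatives chosen in C(g), put
  chi h = sum over c of psi (rep (h c)^-1 * h * rep c).
Each argument of psi lies in B and commutes with g^k; additivity is the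
reindexing of the sum by c |-> h c.  As g^k is central in C(g), it fixes all
cosets, and chi (g^k) = k chi g is the number of cosets times psi (g^k). *)
Lemma transfer g k (psi : G -> int) :
    g ^+ k \in B ->
    (forall x y, x \in B -> y \in B -> commute (g ^+ k) x -> commute (g ^+ k) y ->
       psi (x * y) = (psi x + psi y)%R) ->
  psi (g ^+ k) <> 0%R -> central_char g.
Proof.
move=> gkB psiM psig.
have /finite_seqP[X0 X0E] : finite_set (lcoset @` [set x | commute g x])%classic.
  by apply: sub_finite_set B_index => _ [x _ <-]; exists x.
pose X := undup X0.
have XP c : reflect (exists2 x, commute g x & lcoset x = c) (c \in X).
  rewrite mem_undup; apply: (iffP idP) => [cX|[x gx <-]].
    by have: [set` X0]%classic c by []; rewrite -X0E => -[x gx <-]; exists x.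
  suff: [set` X0]%classic (lcoset x) by [].
  by rewrite -X0E; exists x.
pose rep c := xget 1 [set x | commute g x /\ lcoset x = c]%classic.
have repP c : c \in X -> commute g (rep c) /\ lcoset (rep c) = c.
  move=> /XP[x gx xc].
  by apply: (@xgetPex _ 1 [set x | commute g x /\ lcoset x = c]%classic); exists x.
pose tr h c := lcoset (h * rep c).
have trX h c : commute g h -> c \in X -> tr h c \in X.
  move=> gh /repP[gc _]; apply/XP; exists (h * rep c) => //.
  exact: commuteM.
have trM h h' c : commute g h' -> c \in X -> tr (h * h') c = tr h (tr h' c).
  move=> gh' cX; rewrite /tr -mulgA; apply/lcoset_mull.
  by have [_ ->] := repP _ (trX _ _ gh' cX).
have tr1 c : c \in X -> tr 1 c = c.
  by move=> /repP[_]; rewrite /tr mul1g.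
pose term h c := (rep (tr h c))^-1 * (h * rep c).
have termB h c : commute g h -> c \in X -> term h c \in B.
  by move=> gh cX; apply/lcoset_eq; have [_ ->] := repP _ (trX _ _ gh cX).
have termC h c : commute g h -> c \in X -> commute (g ^+ k) (term h c).
  move=> gh cX; apply/commute_sym/commuteX/commute_sym; apply: commuteM.
    by apply: commuteV; have [] := repP _ (trX _ _ gh cX).
  by apply: commuteM => //; have [] := repP _ cX.
have termM h h' c : commute g h' -> c \in X ->
    term (h * h') c = term h (tr h' c) * term h' c.
  by move=> gh' cX; rewrite /term trM // !mulgA mulgK.
pose chi h : int := (\sum_(c <- X) psi (term h c))%R.
have chiM h h' : commute g h -> commute g h' ->
    chi (h * h') = (chi h + chi h')%R.
  move=> gh gh'; rewrite /chi.
  have tr_perm : perm_eq X [seq tr h' c | c <- X].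
    apply: uniq_perm; rewrite ?undup_uniq //.
      rewrite map_inj_in_uniq ?undup_uniq // => c d /repP[_ cE] /repP[_ dE].
      by move/lcoset_mull; rewrite cE dE.
    move=> c; apply/idP/mapP => [cX|[d dX ->]]; last exact: trX.
    have gh'V : commute g h'^-1 by apply: commuteV.
    by exists (tr h'^-1 c); rewrite ?trX // -trM // mulgV tr1.
  rewrite [X in (X + _)%R](perm_big _ tr_perm) big_map -big_split /=.
  apply: eq_big_seq => c cX; have h'cX := trX _ _ gh' cX.
  by rewrite termM // psiM ?termB //; apply: termC.
exists chi => // chig.
have chiX n : chi (g ^+ n.+1) = 0%R.
  by elim: n => [//|n IHn]; rewrite expgS chiM // ?chig ?IHn //; apply: commuteX.
have chi_gk : chi (g ^+ k) = (psi (g ^+ k)%g *+ size X)%R.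
  rewrite /chi -iter_addr_0 -(count_predT X) -big_const_seq.
  apply: eq_big_seq => c /repP[gc cE].
  have gkc : commute (g ^+ k) (rep c) by apply/commute_sym/commuteX/commute_sym.
  congr psi; rewrite /term.
  suff -> : tr (g ^+ k) c = c by rewrite gkc mulKg.
  by rewrite /tr gkc -[RHS]cE; apply/lcoset_eq; rewrite invgM mulgVK group_closedV.
have sizeX : size X != 0%N.
  rewrite size_eq0; apply/eqP => XE.
  suff: lcoset 1 \in X by rewrite XE.
  by apply/XP; exists 1 => //; apply: commute1.
case: k => [|k] in gkB psiM psig termC chi_gk *.
  apply: psig; apply: (@addrI _ (psi 1)); rewrite addr0 -psiM ?mulg1 //.
move: chi_gk; rewrite chiX => /esym/eqP.
by rewrite mulrn_eq0 (negbTE sizeX) /= => /eqP.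
Qed.

End Transfer.

Lemma commensurable_central_char (G H : groupType) (h : H) :
    commensurable G H -> (forall g : G, g != 1 -> central_char g) ->
  (forall k, 0 < k -> h ^+ k <> 1) -> central_char h.
Proof.
move=> [A [B [A_group B_group _ B_index [f [fM [fAB f_inj f_surj]]]]]] G_char hk.
have [k k_gt0 hkB] := finite_index_power B_group B_index h.
pose f' (y : H) : G := xget 1 [set x | x \in A /\ f x = y]%classic.
have f'P y : y \in B -> f' y \in A /\ f (f' y) = y.
  move=> yB; have [x xA xy] := f_surj y yB.
  by apply: (@xgetPex _ 1 [set x | x \in A /\ f x = y]%classic); exists x.
have f'M x y : x \in B -> y \in B -> f' (x * y) = f' x * f' y.
  move=> xB yB; have [[xA xE] [yA yE]] := (f'P x xB, f'P y yB).
  have [xyA xyE] := f'P _ (group_closedM B_group xB yB).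
  apply: f_inj; rewrite ?inE //; first exact: group_closedM.
  by rewrite fM // xyE xE yE.
have f'1 : f' (h ^+ k) != 1.
  apply/eqP => hk1; apply: (hk k k_gt0); have [_ <-] := f'P _ hkB; rewrite hk1.
  have A1 := A_group.1.
  by apply: (mulgI (f 1)); rewrite -fM // !mulg1.
have [chi chiM chi_neq0] := G_char _ f'1.
apply: (@transfer _ _ B_group B_index h k (chi \o f')) => //= x y xB yB hx hy.
by rewrite f'M // chiM // /commute -!f'M ?hx ?hy.
Qed.

(** * Outer automorphisms of free groups *)

(** A homomorphism to the integers vanishes on the involutions i and i', and on
the commutators t and s, hence on g. *)
Lemma not_central_char (G : groupType) (r r' s t i i' : G) :
    let g := i * t * i * t * (i' * s * i' * s) in
    [/\ commute g r, commute g r', commute g s & commute g t] ->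
    commute g i -> commute g i' -> i * i = 1 -> i' * i' = 1 ->
    s * r = r * t * s -> t * r' = r' * s * t ->
  ~ central_char g.
Proof.
move=> g [gr gr' gs gt] gi gi' ii i'i' sr tr' [chi chiM]; apply.
have chi1 : chi 1 = 0%R.
  by apply: (@addrI _ (chi 1)); rewrite addr0 -chiM ?mulg1 //; apply: commute1.
have chit : chi t = 0%R.
  have := congr1 chi sr; rewrite !chiM //; do ?exact: commuteM.
  by rewrite addrC -addrA => /addrI; rewrite -[LHS]add0r => /addIr.
have chis : chi s = 0%R.
  have := congr1 chi tr'; rewrite !chiM //; do ?exact: commuteM.
  by rewrite addrC -addrA => /addrI; rewrite -[LHS]add0r => /addIr.
have chii : (chi i + chi i = 0)%R by rewrite -chiM ?ii.
have chii' : (chi i' + chi i' = 0)%R by rewrite -chiM ?i'i'.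
rewrite /g !chiM; do ?[exact: commute_refl | assumption | apply: commuteM].
by rewrite chit chis !addr0 chii chii'.
Qed.

Section FreeAut.
Variable X : choiceType.
Local Notation F := (free X).
Local Notation "<< x >>" := (gen set0 x).

Lemma free_aut_ext (f f' : aut F) : (forall x, f <<x>> = f' <<x>>) -> f = f'.
Proof.
by move=> ff'; apply: autP; apply: presented_morph_ext ff' => x y; rewrite aut_morph.
Qed.

Definition subst_fun (x : X) (u : F) : F -> F :=
  free_lift (fun z => if z == x then u else <<z>>).

Lemma subst_funM x u : {morph subst_fun x u : y z / y * z}.
Proof. exact: free_liftM. Qed.

Lemma subst_fun_gen x u z : subst_fun x u <<z>> = if z == x then u else <<z>>.
Proof. exact: free_lift_gen. Qed.

Lemma subst_funK x u u' : subst_fun x u' u = <<x>> ->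
  cancel (subst_fun x u) (subst_fun x u').
Proof.
move=> uu'; apply: (@presented_morph_ext X set0 F (subst_fun x u' \o subst_fun x u) id).
- by move=> y z /=; rewrite !subst_funM.
- by [].
move=> z /=; rewrite subst_fun_gen; case: (z =P x) => [->|/eqP zx] //.
by rewrite subst_fun_gen (negbTE zx).
Qed.

Definition subst_aut x u u' (uu' : subst_fun x u' u = <<x>>)
    (u'u : subst_fun x u u' = <<x>>) : aut F :=
  Aut (@subst_funM x u) (Bijective (subst_funK uu') (subst_funK u'u)).

Lemma transvection_sub x y : x != y ->
  subst_fun x (<<x>> * <<y>>^-1) (<<x>> * <<y>>) = <<x>>.
Proof.
move=> xy; rewrite subst_funM !subst_fun_gen eqxx eq_sym (negbTE xy).
by rewrite mulgVK.
Qed.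

Lemma transvection_subV x y : x != y ->
  subst_fun x (<<x>> * <<y>>) (<<x>> * <<y>>^-1) = <<x>>.
Proof.
move=> xy; rewrite subst_funM morphV; last exact: subst_funM.
by rewrite !subst_fun_gen eqxx eq_sym (negbTE xy) mulgK.
Qed.

Definition transvection x y (xy : x != y) : aut F :=
  subst_aut (transvection_sub xy) (transvection_subV xy).

Lemma transvection_gen x y (xy : x != y) z :
  transvection xy <<z>> = if z == x then <<x>> * <<y>> else <<z>>.
Proof. exact: subst_fun_gen. Qed.

Lemma inversion_sub x : subst_fun x <<x>>^-1 <<x>>^-1 = <<x>>.
Proof.
by rewrite morphV ?subst_fun_gen ?eqxx ?invgK //; apply: subst_funM.
Qed.

Definition inversion x : aut F := subst_aut (inversion_sub x) (inversion_sub x).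

Lemma inversion_gen x z :
  inversion x <<z>> = if z == x then <<x>>^-1 else <<z>>.
Proof. exact: subst_fun_gen. Qed.

Section Twist.
Variables a b c : X.
Hypotheses (ba : b != a) (ca : c != a) (bc : b != c).

Let cb : c != b. Proof. by rewrite eq_sym. Qed.

(** With i : b |-> b^-1 and t : b |-> ba, the product i t i t is the conjugation
of b by a; likewise for c. *)
Definition twist : aut F :=
  inversion b * transvection ba * inversion b * transvection ba *
  (inversion c * transvection ca * inversion c * transvection ca).

Lemma aut_mulE (f f' : aut F) z : (f * f') z = f (f' z).
Proof. by []. Qed.

Let neqs := (eqxx, negbTE ba, negbTE ca, negbTE bc, negbTE cb,
   etrans (eq_sym a b) (negbTE ba), etrans (eq_sym a c) (negbTE ca)).

Let gensE :=
  (aut_mulE, @aut_morph F, @autV F, transvection_gen, inversion_gen, neqs).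

Lemma twist_b : twist <<b>> = <<a>>^-1 * <<b>> * <<a>>.
Proof. by do !rewrite /twist !gensE; rewrite invgM invgK. Qed.

Lemma twist_c : twist <<c>> = <<a>>^-1 * <<c>> * <<a>>.
Proof. by do !rewrite /twist !gensE; rewrite invgM invgK. Qed.

Lemma twist_fix z : z != b -> z != c -> twist <<z>> = <<z>>.
Proof. by move=> /negbTE zb /negbTE zc; rewrite /twist !(gensE, zb, zc). Qed.

Lemma aut_ext_bc (f f' : aut F) :
    f <<b>> = f' <<b>> -> f <<c>> = f' <<c>> ->
    (forall z, z != b -> z != c -> f <<z>> = f' <<z>>) ->
  f = f'.
Proof.
move=> fb fc fz; apply: free_aut_ext => z.
have [->//|zb] := eqVneq z b; have [->//|zc] := eqVneq z c.
exact: fz.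
Qed.

Lemma twist_not_central_char : ~ central_char twist.
Proof.
have twist_a : twist <<a>> = <<a>> by apply: twist_fix; rewrite eq_sym.
pose gE := (@aut_morph F, @autV F, twist_b, twist_c, twist_a,
  @transvection_gen, @inversion_gen, aut_mulE, neqs).
pose wordE := (@invgM F, @invgK F, @mulgA F, @mulgK F, @mulgVK F, @mulVg F,
  @mulgV F, @mul1g F, @mulg1 F).
apply: (@not_central_char _ (transvection bc) (transvection cb)).
- by split; (apply: aut_ext_bc => [||z zb zc];
    last by rewrite !(gE, twist_fix zb zc, negbTE zb, negbTE zc));
  rewrite !gE ?wordE.
1-2: rewrite -/twist.
all: apply: aut_ext_bc => [||z zb zc];
  last by rewrite ?(gE, twist_fix zb zc, negbTE zb, negbTE zc).
all: by rewrite !gE ?wordE.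
Qed.

End Twist.

(** Positive words are reduced, so different ones represent different
elements. *)
Lemma free_gen_noncomm (x y : X) n : x != y -> ~ commute (<<x>> ^+ n.+1) <<y>>.
Proof.
move=> xy; pose pos (s : seq X) : word X := [seq (z, false) | z <- s].
have pos_red s : reduced (pos s).
  case: s => //= z s; elim: s z => //= t s IHs z; rewrite IHs andbT.
  by rewrite xpair_eqE andbF.
have posX k : <<x>> ^+ k = \pi_F%qT (pos (nseq k x)).
  by elim: k => // k IHk; rewrite expgS IHk -pres_piM.
move=> xyC; have : \pi_F%qT (pos (rcons (nseq n.+1 x) y)) =
                  \pi_F%qT (pos (y :: nseq n.+1 x)).
  rewrite {1}/pos map_rcons -cats1 pres_piM -/(pos _) -posX [LHS]xyC posX.
  by rewrite -pres_piM.
move=> /presented_piP /asboolP /nf_pres; rewrite !nf_id // => -[xE].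
by rewrite xE eqxx in xy.
Qed.

(** If g^k were conjugation by x, then x would commute with d and conjugate b to
a^-k b a^k.  Identifying b with d makes the images of d and a^k
commute, which fails in a free group. *)
Lemma twist_outer a b c d (ba : b != a) (ca : c != a) (bc : b != c) k :
    d \notin [:: a; b; c] -> 0 < k ->
  \pi_(out F)%qT (twist ba ca) ^+ k <> 1.
Proof.
rewrite !inE !negb_or => /and3P[da db dc] k_gt0.
set g := twist ba ca.
have -> : \pi_(out F)%qT g ^+ k = \pi_(out F)%qT (g ^+ k).
  elim: k {k_gt0} => // k IHk; rewrite !expgS IHk.
  by rewrite -[LHS]/(out_mul _ _) out_mulE.
move=> gk1; have /out_piP/asboolP[x gx] :
    \pi_(out F)%qT (g ^+ k) = \pi_(out F)%qT (1 : aut F) by [].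
have {}gx z : (g ^+ k) z = x * z * x^-1 by rewrite gx.
have gXb n : (g ^+ n) <<b>> = <<a>> ^- n * <<b>> * <<a>> ^+ n.
  elim: n => [|n IHn]; first by rewrite invg1 mul1g mulg1.
  have ga : (g ^+ n) <<a>> = <<a>>.
    elim: n {IHn} => // n IHn; rewrite expgS aut_mulE IHn.
    by rewrite twist_fix // eq_sym.
  rewrite expgSr aut_mulE twist_b // !aut_morph autV ga IHn.
  by rewrite expgSr invgM !mulgA.
have gXd n : (g ^+ n) <<d>> = <<d>>.
  by elim: n => // n IHn; rewrite expgS aut_mulE IHn twist_fix.
(* the endomorphism identifying b with d *)
pose th : F -> F := free_lift (fun z => if z == b then <<d>> else <<z>>).
have thM : {morph th : y z / y * z} by exact: free_liftM.
have thE z : th <<z>> = if z == b then <<d>> else <<z>> by exact: free_lift_gen.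
have thX n : th (<<a>> ^+ n) = <<a>> ^+ n.
  elim: n => [|n IHn]; first exact: morph1.
  by rewrite !expgS thM IHn thE eq_sym (negbTE ba).
have ead : x * <<d>> * x^-1 = <<d>> by rewrite -gx gXd.
have := congr1 th (gXb k); rewrite gx.
have thb : th <<b>> = th <<d>> by rewrite !thE eqxx (negbTE db).
rewrite !thM thb -!thM ead !thM (morphV thM) thX thE (negbTE db) => dk.
case: k k_gt0 {gx gk1} dk => // k _ dk.
apply: (@free_gen_noncomm a d k); first by rewrite eq_sym.
by rewrite /commute {1}dk -mulgA mulVKg.
Qed.

End FreeAut.

Theorem theorem8 (n : nat) (hn : 4 <= n) (V : finType) (e : rel V)
    (e_sym : symmetric e) (e_irr : irreflexive e) :
  ~ commensurable (raag e) (out (free_group n)).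
Proof.
move=> comm.
pose x i (i4 : i < 4) : 'I_n := Ordinal (leq_trans i4 hn).
have x10 : x 1%N isT != x 0%N isT by [].
have x20 : x 2 isT != x 0%N isT by [].
have x12 : x 1%N isT != x 2 isT by [].
apply: (@twist_not_central_char _ _ _ _ x10 x20 x12).
apply: (@central_char_pullback _ _ (fun f => \pi_(out (free 'I_n))%qT f)).
  by move=> f g; rewrite -[RHS]/(out_mul _ _) out_mulE.
apply: (commensurable_central_char comm) => [g|k k_gt0].
  exact: raag_central_char.
exact: (@twist_outer _ _ _ _ (x 3 isT)).
Qed.
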